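(* Let $G$ be a finite non-nilpotent group such that every nontrivial element of $G/Z(G)$ has prime power order. Then $$|\mathcal{D}(G)|\geq l_M\left(\frac{G}{Z(G)}\right)+1.$$
   Context: For a finite group $G$ and a subgroup $H\leq G$, the relative commutativity degree of $H$ in $G$ is $$d(H,G)=\frac{\#\{(h,g)\in H\times G : hg=gh\}}{|H||G|},$$ and $\mathcal{D}(G)=\{d(H,G) : H\leq G\}$. $Z(G)$ denotes the center of $G$. For a finite group $X$, $l_M(X)$ denotes the maximum length of chains of subgroups of $X$, i.e. the largest $n$ for which there is a chain of subgroups $X_0<X_1<\cdots<X_n$ of $X$ with all inclusions strict. *)

(* Defs.v *)
From mathcomp Require Import all_boot all_order all_algebra all_fingroup all_solvable.

Set Implicit Arguments.
Unset Strict Implicit.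
Unset Printing Implicit Defensive.

Import GRing.Theory.
Local Open Scope group_scope.

Section RelativeCommutativity.
Variable gT : finGroupType.

Definition rel_comm_deg (H G : {set gT}) : rat :=
  (#|[set p in setX H G | p.1 * p.2 == p.2 * p.1]%g|%:R / (#|H| * #|G|)%N%:R)%R.

(* The set {d(H, G) : H <= G}, as a duplicate-free sequence, so that its
   cardinality is its size. *)
Definition rel_comm_degs (G : {set gT}) : seq rat :=
  undup [seq rel_comm_deg H G | H : {group gT} in subgroups G].

End RelativeCommutativity.

Section ChainLength.
Variable gT : finGroupType.

(* There is a chain X_0 < X_1 < ... < X_n of subgroups of X; its length n is
   the number of strict inclusions. *)
Definition has_subgroup_chain (X : {set gT}) (n : nat) : bool :=
  [exists c : n.+1.-tuple {group gT},
     all (fun H : {group gT} => H \subset X) c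
     && sorted (fun H K : {group gT} => H \proper K) c].

Definition max_chain_length (X : {set gT}) : nat :=
  \max_(n < #|X| | has_subgroup_chain X n) n.

(* The bound n < #|X| in max_chain_length loses no chain. *)
Lemma has_subgroup_chain_lt (X : {set gT}) n :
  has_subgroup_chain X n -> n < #|X|.
Proof.
case/existsP=> -[[|H c] //= /eqP[sz_c]] /andP[/andP[sHX sX] hc].
suff: #|H| + size c <= #|X|.
  by apply: leq_trans; rewrite -sz_c -add1n leq_add2r cardG_gt0.
elim: c H sHX sX hc {sz_c} => [|K c IH] H sHX /=.
  by rewrite addn0 => _ _; apply: subset_leq_card.
case/andP=> sKX sX /andP[ltHK hc]; apply: leq_trans (IH K sKX sX hc).
by rewrite addnS -addSn leq_add2r proper_card.
Qed.

Lemma max_chain_lengthP (X : {group gT}) :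
  has_subgroup_chain X (max_chain_length X)
  /\ forall n, has_subgroup_chain X n -> n <= max_chain_length X.
Proof.
split=> [|n ch_n].
  have ch0 : has_subgroup_chain X 0.
    by apply/existsP; exists [tuple X]; rewrite /= subxx.
  rewrite /max_chain_length.
  have X0 : 0 < #|X| by apply: cardG_gt0.
  by rewrite (bigmax_eq_arg (Ordinal X0)) //; case: arg_maxnP.
exact: (bigmax_sup (Ordinal (has_subgroup_chain_lt ch_n))).
Qed.

End ChainLength.

(* Main.v *)
Require Import Defs.
From mathcomp Require Import all_boot all_order all_algebra all_fingroup all_solvable.

(** The relative commutativity degree is the average over [g] in [G] of the
    proportion of [H] that centralises [g], that is, of [1 / #|H : 'C_H[g]|].
    For subgroups [H \subset K] of [G], each of these proportions can only go
    down from [H] to [K], since [#|'C_K[g] : 'C_H[g]| <= #|K : H|]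
    ([leq_index_subcent1]); so the degree is unchanged only if this index
    inequality is an equality for every [g] in [G].

    Suppose that it is, with ['Z(G) \subset H \proper K], and let [p] be a prime
    divisor of [#|K : H|].  When [coset 'Z(G) g] has prime order [q], the
    quotient ['C_K[g] / 'Z(G)] centralises it.  Two commuting elements of
    distinct prime orders have a product whose order is not a prime power, so
    ['C_K[g] / 'Z(G)] is a [q]-group ([pgroup_subcent1_prime]).  Its order is a
    multiple of [#|'C_K[g] : 'C_H[g]| = #|K : H|], whence [p = q].  Thus [p] is
    the only prime divisor of [#|G / 'Z(G)|], and [G] is nilpotent, being a
    central extension of a [p]-group ([ex_index_subcent1_lt]).

    For non-nilpotent [G] the degree therefore drops strictly along any strict
    chain of subgroups that contain ['Z(G)] ([rel_comm_deg_lt]), and a chain of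
    length [n] in [G / 'Z(G)] lifts to such a chain of [n + 1] subgroups. *)

Import Order.TTheory GRing.Theory Num.Theory.
Local Open Scope group_scope.

(** An element of prime order [r != #[x]] commuting with [x] would give an
    element of order [#[x] * r], which is not a prime power. *)
Lemma pgroup_subcent1_prime (gT : finGroupType) (Q : {group gT}) x :
    (forall y, y \in Q -> y != 1 ->
       exists p k : nat, prime p /\ #[y] = (p ^ k)%N) ->
    x \in Q -> prime #[x] ->
  #[x].-group 'C_Q[x].
Proof.
move=> ppowQ Qx pr_x; apply/pgroupP=> r pr_r /(Cauchy pr_r)[y /setIP[Qy cxy] oy].
rewrite inE /=; apply/idPn => neq_rx.
have co_xy: coprime #[x] r by rewrite prime_coprime // dvdn_prime2 // eq_sym.
have oxy: #[x * y] = (#[x] * r)%N.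
  by rewrite orderM ?oy //; apply: commute_sym; apply/cent1P.
have xy_neq1: x * y != 1.
  by rewrite -order_gt1 oxy (leq_trans (prime_gt1 pr_r)) ?leq_pmull ?prime_gt0.
have [p [k [pr_p def_pk]]] := ppowQ (x * y) (groupM Qx Qy) xy_neq1.
have dvd_p s: prime s -> s %| #[x * y] -> s = p.
  move=> pr_s; rewrite def_pk Euclid_dvdX // => /andP[].
  by rewrite dvdn_prime2 // => /eqP.
case/eqP: neq_rx.
have ->: r = p by apply: dvd_p pr_r _; rewrite oxy dvdn_mull.
by apply/esym/dvd_p; rewrite // oxy dvdn_mulr.
Qed.

Section CentraliserIndices.

Variable gT : finGroupType.
Implicit Types G H K : {group gT}.

Lemma leq_index_subcent1 H K g :
  H \subset K -> #|'C_K[g] : 'C_H[g]| <= #|K : H|.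
Proof.
move=> sHK; have ->: 'C_H[g] = 'C_K[g] :&: H by rewrite setIAC (setIidPr sHK).
by rewrite indexgI; apply/subset_leq_card/imsetS/subsetIl.
Qed.

(** The prime [p] below depends on [#|K : H|] only and not on [g]: this is what
    forces a single prime on the whole of [G / 'Z(G)]. *)
Lemma ex_index_subcent1_lt G H K :
    ~~ nilpotent G ->
    (forall x, x \in G / 'Z(G) -> x != 1 ->
       exists p k : nat, prime p /\ #[x] = (p ^ k)%N) ->
    'Z(G) \subset H -> H \proper K -> K \subset G ->
  exists2 g, g \in G & #|'C_K[g] : 'C_H[g]| < #|K : H|.
Proof.
move=> nnilG ppow sZH ltHK sKG; have sHK := proper_sub ltHK.
apply/exists_inP; apply: contraNT nnilG => /exists_inPn eq_index.
have KH_gt1: 1 < #|K : H| by rewrite indexg_gt1 proper_subn.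
set p := pdiv #|K : H|.
rewrite -quotient_center_nil; apply: (@pgroup_nil _ p).
apply/pgroupP=> q pr_q /(Cauchy pr_q)[_ /morphimP[g nZg Gg ->] oq].
have sZC: 'Z(G) \subset 'C_H[g].
  rewrite subsetI sZH sub_cent1; apply: subsetP Gg.
  by rewrite centsC subsetIr.
have dvdp: p %| #|'C_K[g] / 'Z(G)|.
  rewrite card_quotient; last first.
    by apply: subset_trans (normal_norm (center_normal G)); rewrite subIset ?sKG.
  have ->: #|'C_K[g] : 'Z(G)| = (#|'C_K[g] : 'C_H[g]| * #|'C_H[g] : 'Z(G)|)%N.
    by rewrite Lagrange_index ?setSI.
  have ->: #|'C_K[g] : 'C_H[g]| = #|K : H|.
    by apply/eqP; rewrite eqn_leq leq_index_subcent1 //= leqNgt eq_index.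
  by rewrite dvdn_mulr ?pdiv_dvd.
have qC: q.-group ('C_K[g] / 'Z(G)).
  rewrite -oq; apply: pgroupS (pgroup_subcent1_prime _ _ _ ppow _ _).
  - rewrite subsetI quotientS ?(subset_trans (subsetIl _ _)) //=.
    by apply: subset_trans (quotient_subcent1 _ _ _) (subsetIr _ _).
  - exact: mem_quotient.
  - by rewrite oq.
by have := pgroupP qC p (pdiv_prime KH_gt1) dvdp; rewrite !inE eq_sym.
Qed.

End CentraliserIndices.

Section StrictMonotonicity.

Variable gT : finGroupType.
Implicit Types G H K : {group gT}.

Lemma card_commuting_pairs (H G : {set gT}) :
  #|[set p in setX H G | p.1 * p.2 == p.2 * p.1]| = \sum_(g in G) #|'C_H[g]|.
Proof.
under [RHS]eq_bigr => g _ do rewrite -sum1_card.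
rewrite -sum1_card (exchange_big_dep (mem H)) /=; last by move=> g h _ /setIP[].
rewrite pair_big_dep /=; apply: eq_bigl => -[h g] /=.
rewrite inE in_setX in_setI cent1E /= -andbA.
by case: (h \in H).
Qed.

Lemma rel_comm_deg_lt G H K :
    ~~ nilpotent G ->
    (forall x, x \in G / 'Z(G) -> x != 1 ->
       exists p k : nat, prime p /\ #[x] = (p ^ k)%N) ->
    'Z(G) \subset H -> H \proper K -> K \subset G ->
  (rel_comm_deg K G < rel_comm_deg H G)%R.
Proof.
move=> nnilG ppow sZH ltHK sKG; have sHK := proper_sub ltHK.
have [g0 Gg0 lt_g0] := ex_index_subcent1_lt _ G H K nnilG ppow sZH ltHK sKG.
have cardCK g: #|'C_K[g]| = (#|'C_H[g]| * #|'C_K[g] : 'C_H[g]|)%N.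
  by rewrite Lagrange ?setSI.
have lt_sum: \sum_(g in G) #|'C_K[g]| < #|K : H| * \sum_(g in G) #|'C_H[g]|.
  rewrite big_distrr /= (bigD1 g0) //= [ltnRHS](bigD1 g0) //= -addSn.
  apply: leq_add.
    by rewrite cardCK mulnC ltn_pmul2r ?cardG_gt0.
  by apply: leq_sum => g _; rewrite cardCK mulnC leq_mul2r leq_index_subcent1 ?orbT.
rewrite /rel_comm_deg !card_commuting_pairs.
rewrite ltr_pdivrMr ?ltr0n ?muln_gt0 ?cardG_gt0 // mulrAC.
rewrite ltr_pdivlMr ?ltr0n ?muln_gt0 ?cardG_gt0 // -!natrM ltr_nat.
rewrite -(Lagrange sHK) !mulnA ltn_pmul2r ?cardG_gt0 //.
by rewrite [ltnRHS]mulnAC ltn_pmul2r ?cardG_gt0 // mulnC.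
Qed.

End StrictMonotonicity.

Theorem lemma4p3 (gT : finGroupType) (G : {group gT})
    (nnilG : ~~ nilpotent G)
    (ppow : forall x, x \in G / 'Z(G) -> x != 1 ->
       exists p k : nat, prime p /\ #[x] = (p ^ k)%N) :
  max_chain_length (G / 'Z(G)) + 1 <= size (rel_comm_degs G).
Proof.
have [/existsP[c /andP[/allP sXG ltX]] _] := max_chain_lengthP (G / 'Z(G))%G.
pose lift (X : {group coset_of 'Z(G)}) := (coset 'Z(G) @*^-1 X)%G.
have sliftG X: X \in (c : seq _) -> lift X \subset G.
  by move/sXG=> sX; rewrite sub_cosetpre_quo ?center_normal.
pose degs := [seq rel_comm_deg (lift X) G | X : {group _} <- c].
have degs_uniq: uniq degs.
  apply: (@sorted_uniq _ (fun a b : rat => (b < a)%R)).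
  - by move=> a b d lt_ab lt_da; apply: lt_trans lt_da lt_ab.
  - by move=> a; apply: ltxx.
  rewrite sorted_map; apply: (sub_in_sorted (P := mem c)) ltX; last exact/allP.
  move=> X Y _ Yc ltXY; apply: rel_comm_deg_lt => //; last exact: sliftG.
    exact: sub_cosetpre.
  by rewrite cosetpre_proper.
have ->: max_chain_length (G / 'Z(G)) + 1 = size degs.
  by rewrite size_map size_tuple addn1.
apply: uniq_leq_size => // _ /mapP[X Xc ->].
rewrite mem_undup; apply: (image_f (fun H : {group gT} => rel_comm_deg H G)).
by rewrite inE sliftG.
Qed.
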